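(* Let $A\in\mathbb{R}^{m\times n}$, $y\in\mathbb{R}^m$, $f(x)=\|y-Ax\|_2^2$, let $q$ be a positive integer, $\alpha>0$, $\gamma>0$, and let $x^{(p)}\in\mathbb{R}^n$. Let $\Omega^p=\mathcal{L}_q(A^\top(y-Ax^{(p)}))$ and assume $A_{\Omega^p}^\top A_{\Omega^p}$ is invertible. If $A^\top(y-Ax^{(p)})\ne\mathbf 0$, then the compressed Newton direction $$\mathbf d_{\mathrm{CN}}:=M(\Omega^p)Z(\Omega^p)A^\top(y-Ax^{(p)})$$ is a descent direction for $f$ at $x^{(p)}$, i.e. $(\nabla f(x^{(p)}))^\top\mathbf d_{\mathrm{CN}}<0$.
   Context: $\mathcal{L}_q(z)$ is the support of $\mathcal{H}_q(z)$, the vector obtained from $z$ by keeping its $q$ largest-magnitude entries (ties broken by any fixed rule) and setting the others to zero. $A_\Omega$ is the submatrix of columns of $A$ indexed by $\Omega\subseteq\{1,\dots,n\}$. $M(\Omega)\in\mathbb{R}^{n\times n}$ is the matrix with principal submatrix $M(\Omega)_{\Omega\times\Omega}=(A_\Omega^\top A_\Omega)^{-1}$, diagonal entries $[M(\Omega)]_{ii}=\alpha$ for $i\notin\Omega$, and all other entries zero. $Z(\Omega)=\operatorname{diag}(z_1,\dots,z_n)$ with $z_i=1$ for $i\in\Omega$ and $z_i=\gamma$ for $i\notin\Omega$. *)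

(* Defs.v *)
From mathcomp Require Import all_boot all_order all_algebra.
From mathcomp Require Import all_classical all_reals all_analysis.

Set Implicit Arguments.
Unset Strict Implicit.
Unset Printing Implicit Defensive.
Import Order.TTheory GRing.Theory Num.Theory.
Import numFieldNormedType.Exports.
Local Open Scope ring_scope.

Definition l2norm (R : realType) (k : nat) (v : 'cV[R]_k) : R :=
  Num.sqrt (\sum_(i < k) v i 0 ^+ 2).

Definition least_squares (R : realType) (m n : nat) (A : 'M[R]_(m, n))
    (y : 'cV[R]_m) : 'cV[R]_n -> R :=
  fun x => l2norm (y - A *m x) ^+ 2.

Definition gradient (R : realType) (n : nat) (f : 'cV[R]_n -> R)
    (x : 'cV[R]_n) : 'cV[R]_n :=
  \col_i 'D_(delta_mx i 0 : 'cV[R]_n) f x.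

Definition descent_direction (R : realType) (n : nat) (f : 'cV[R]_n -> R)
    (x d : 'cV[R]_n) : Prop :=
  ((gradient f x)^T *m d) 0 0 < 0.

(* [H] is a version of the operator H_q.  When several sets of q
   largest-magnitude entries exist (ties), H is free to select any of them, but
   being a function of z it does so by a fixed rule.  If q > n, all entries are
   kept. *)
Definition hard_thresholding (R : realType) (n q : nat)
    (H : 'cV[R]_n -> 'cV[R]_n) : Prop :=
  forall z : 'cV[R]_n, exists S : {set 'I_n},
    [/\ #|S| = minn q n,
        forall i j, i \in S -> j \notin S -> `|z j 0| <= `|z i 0|
      & H z = \col_i (if i \in S then z i 0 else 0)].

Definition vsupport (R : realType) (n : nat) (z : 'cV[R]_n) : {set 'I_n} :=
  [set i | z i 0 != 0].

(* [enum_val] lists the elements of [Om] in increasing order. *)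
Definition colsubset (R : realType) (m n : nat) (A : 'M[R]_(m, n))
    (Om : {set 'I_n}) : 'M[R]_(m, #|Om|) :=
  colsub (fun k : 'I_#|Om| => enum_val k) A.

Definition gram (R : realType) (m n : nat) (A : 'M[R]_(m, n))
    (Om : {set 'I_n}) : 'M[R]_#|Om| :=
  (colsubset A Om)^T *m colsubset A Om.

(* The [pick]s compute the ranks of i and j in [Om]; a [pick] fails exactly when
   the index is outside [Om], see the three characterizing lemmas below. *)
Definition cnM (R : realType) (m n : nat) (A : 'M[R]_(m, n)) (alpha : R)
    (Om : {set 'I_n}) : 'M[R]_n :=
  \matrix_(i, j)
    match [pick k : 'I_#|Om| | enum_val k == i],
          [pick l : 'I_#|Om| | enum_val l == j] with
    | Some k, Some l => invmx (gram A Om) k l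
    | _, _ => if i == j then alpha else 0
    end.

Lemma cnM_principal (R : realType) (m n : nat) (A : 'M[R]_(m, n)) (alpha : R)
    (Om : {set 'I_n}) :
  mxsub (fun k : 'I_#|Om| => enum_val k) (fun k : 'I_#|Om| => enum_val k)
    (cnM A alpha Om) = invmx (gram A Om).
Proof.
apply/matrixP => k l; rewrite !mxE.
case: pickP => [k' /eqP /enum_val_inj ->|/(_ k)]; last by rewrite eqxx.
by case: pickP => [l' /eqP /enum_val_inj ->|/(_ l)]; last by rewrite eqxx.
Qed.

Lemma cnM_diag (R : realType) (m n : nat) (A : 'M[R]_(m, n)) (alpha : R)
    (Om : {set 'I_n}) (i : 'I_n) :
  i \notin Om -> cnM A alpha Om i i = alpha.
Proof.
move=> iOm; rewrite !mxE eqxx; case: pickP => // k /eqP ki.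
by rewrite -ki enum_valP in iOm.
Qed.

Lemma cnM_off (R : realType) (m n : nat) (A : 'M[R]_(m, n)) (alpha : R)
    (Om : {set 'I_n}) (i j : 'I_n) :
  i != j -> ~~ ((i \in Om) && (j \in Om)) -> cnM A alpha Om i j = 0.
Proof.
move=> /negbTE ij nOm; rewrite !mxE ij.
case: pickP => // k /eqP ki; case: pickP => // l /eqP lj.
by rewrite -ki -lj !enum_valP in nOm.
Qed.

Definition cnZ (R : realType) (n : nat) (gamma : R) (Om : {set 'I_n}) :
    'M[R]_n :=
  diag_mx (\row_i (if i \in Om then 1 else gamma)).

Definition compressed_newton_direction (R : realType) (m n : nat)
    (A : 'M[R]_(m, n)) (y : 'cV[R]_m) (alpha gamma : R) (Om : {set 'I_n})
    (x : 'cV[R]_n) : 'cV[R]_n :=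
  cnM A alpha Om *m cnZ gamma Om *m A^T *m (y - A *m x).

(* Main.v *)
Require Import Defs.
From mathcomp Require Import all_boot all_order all_algebra.
From mathcomp Require Import all_classical all_reals all_analysis.
From mathcomp Require Import ring.

Import Order.TTheory GRing.Theory Num.Theory.
Import numFieldNormedType.Exports.
Local Open Scope ring_scope.

(** The gradient of [f] at [x] is [-2 g] with [g = A^T (y - A x)], so the claim
    is [g^T M Z g > 0].  Splitting [g] along [Om] gives
    [g^T M Z g = u^T G^-1 u + alpha gamma sum_(i notin Om) g_i^2], where [u] is
    the restriction of [g] to [Om] and [G] the Gram matrix of the columns in
    [Om].  As [G] is invertible, it is positive definite, and so is its inverse;
    both terms are nonnegative and they vanish together only if [g = 0]. *)

Lemma sqr_l2norm (R : realType) (k : nat) (v : 'cV[R]_k) :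
  l2norm v ^+ 2 = (v^T *m v) 0 0.
Proof.
rewrite sqr_sqrtr; last by apply: sumr_ge0 => i _; exact: sqr_ge0.
by rewrite mxE; apply: eq_bigr => i _; rewrite mxE expr2.
Qed.

Lemma trmx_mul_self_ge0 (R : realType) (k : nat) (v : 'cV[R]_k) :
  0 <= (v^T *m v) 0 0.
Proof. by rewrite -sqr_l2norm sqr_ge0. Qed.

Lemma trmx_mul_self_eq0 (R : realType) (k : nat) (v : 'cV[R]_k) :
  (v^T *m v) 0 0 = 0 -> v = 0.
Proof.
rewrite mxE => /psumr_eq0P sq0; apply/colP => i; rewrite [RHS]mxE.
have /eqP : v^T 0 i * v i 0 = 0.
  by apply: sq0 => // j _; rewrite mxE -expr2 sqr_ge0.
by rewrite mxE mulf_eq0 orbb => /eqP.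
Qed.

Lemma trmx_mul_comm (R : realType) (k : nat) (u v : 'cV[R]_k) :
  (u^T *m v) 0 0 = (v^T *m u) 0 0.
Proof. by rewrite !mxE; apply: eq_bigr => i _; rewrite !mxE mulrC. Qed.

(** Since [f] is quadratic, the expansion is exact. The factor [h] is pulled out so that it cancels
    in the difference quotient defining ['D_v f x]. *)
Lemma least_squares_addZ (R : realType) (m n : nat) (A : 'M[R]_(m, n))
    (y : 'cV[R]_m) (x v : 'cV[R]_n) (h : R) :
  least_squares A y (h *: v + x) - least_squares A y x =
  h * (h * ((A *m v)^T *m (A *m v)) 0 0 -
       2 * (v^T *m (A^T *m (y - A *m x))) 0 0).
Proof.
rewrite /least_squares !sqr_l2norm (mulmxDr A) -scalemxAr.
set r := y - A *m x; set w := A *m v.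
have -> : y - (h *: w + A *m x) = r - h *: w.
  by rewrite opprD addrCA addrC addrAC.
have -> : v^T *m (A^T *m r) = w^T *m r by rewrite mulmxA -trmx_mul.
clearbody r w; have := trmx_mul_comm _ _ r w.
have -> : (r - h *: w)^T = r^T - h *: w^T by apply/rowP => i; rewrite !mxE.
rewrite mulmxBl !mulmxBr -!scalemxAl -!scalemxAr !mxE.
by move=> ->; ring.
Qed.

Lemma gradient_least_squares (R : realType) (m n : nat) (A : 'M[R]_(m, n))
    (y : 'cV[R]_m) (x : 'cV[R]_n) :
  gradient (least_squares A y) x = - 2 *: (A^T *m (y - A *m x)).
Proof.
apply/colP => i; rewrite mxE [RHS]mxE; set g := A^T *m _.
pose e : 'cV[R]_n := delta_mx i 0; pose c := ((A *m e)^T *m (A *m e)) 0 0.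
have ge : (e^T *m g) 0 0 = g i 0 by rewrite trmx_delta -rowE mxE.
apply: cvg_lim => //.
(* The difference quotient equals this affine function of [h] only for [h != 0], which suffices in
   the punctured neighbourhood filter. *)
apply: (@cvg_trans _ ((fun h : R => h * c - 2 * g i 0) @ 0^')%classic).
  apply: near_eq_cvg; near=> h.
  have h0 : h != 0 by near: h; exact: nbhs_dnbhs_neq.
  by rewrite /= least_squares_addZ ge -/c [_ *: _]mulrA mulVf ?mul1r.
(* The limit is put in the form of the affine function at [h = 0], so that the limit rules apply
   termwise. *)
have -> : - 2 * g i 0 = 0 * c - 2 * g i 0 by ring.
apply: cvg_within_filter; apply: cvgB; last exact: cvg_cst.
by apply: cvgMl; exact: cvg_id.
Unshelve. all: by end_near. Qed.

(** The inclusion of the coordinate subspace indexed by [Om]; its transpose restricts a vector to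
    [Om]. *)
Definition colincl (R : realType) (n : nat) (Om : {set 'I_n}) :
    'M[R]_(n, #|Om|) := colsubset 1%:M Om.

Lemma colinclE (R : realType) (n : nat) (Om : {set 'I_n}) i k :
  colincl R n Om i k = (i == enum_val k)%:R.
Proof. by rewrite !mxE. Qed.

Lemma row_colincl_in (R : realType) (n : nat) (Om : {set 'I_n}) k :
  row (enum_val k) (colincl R n Om) = delta_mx 0 k.
Proof.
by apply/rowP => l; rewrite mxE colinclE mxE (inj_eq enum_val_inj) eq_sym.
Qed.

Lemma row_colincl_notin (R : realType) (n : nat) (Om : {set 'I_n}) i :
  i \notin Om -> row i (colincl R n Om) = 0.
Proof.
move=> iOm; apply/rowP => l; rewrite mxE colinclE mxE.
by case: eqP iOm => // ->; rewrite enum_valP.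
Qed.

Lemma trmx_colincl_mulE (R : realType) (n : nat) (Om : {set 'I_n})
    (v : 'cV[R]_n) k :
  ((colincl R n Om)^T *m v) k 0 = v (enum_val k) 0.
Proof.
rewrite mxE (bigD1 (enum_val k)) //= mxE colinclE eqxx mul1r big1 ?addr0 //.
by move=> j /negbTE jk; rewrite mxE colinclE jk mul0r.
Qed.

Lemma colincl_conjE (R : realType) (n : nat) (Om : {set 'I_n})
    (W : 'M[R]_#|Om|) i j :
  (colincl R n Om *m W *m (colincl R n Om)^T) i j =
  (row i (colincl R n Om) *m W *m (row j (colincl R n Om))^T) 0 0.
Proof. by rewrite -row_mul !mxE; apply: eq_bigr => l _; rewrite !mxE. Qed.

(** The rows of [colincl] are unit vectors on [Om] and zero elsewhere, so conjugating by it places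
    the inverse Gram matrix in the [Om] block and zeros around it. *)
Lemma cnM_decomp (R : realType) (m n : nat) (A : 'M[R]_(m, n)) (alpha : R)
    (Om : {set 'I_n}) :
  cnM A alpha Om =
  colincl R n Om *m invmx (gram A Om) *m (colincl R n Om)^T +
  diag_mx (\row_i (if i \in Om then 0 else alpha)).
Proof.
apply/matrixP => i j; rewrite [RHS]mxE colincl_conjE.
have [iOm|iOm] := boolP (i \in Om); last first.
  rewrite row_colincl_notin // !mul0mx [X in _ = X + _]mxE add0r.
  have [<-|ij] := eqVneq i j; first by rewrite cnM_diag //
    !mxE eqxx (negbTE iOm).
  by rewrite cnM_off ?(negbTE iOm) // !mxE (negbTE ij).
have [jOm|jOm] := boolP (j \in Om); last first.
  have ij : i != j by apply: contraNneq jOm => <-.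
  rewrite cnM_off ?(negbTE jOm) ?andbF // (row_colincl_notin _ _ _ _ jOm).
  by rewrite trmx0 mulmx0 !mxE (negbTE ij) addr0.
(* Both indices are expressed through their ranks in [Om], where [cnM_principal] reads off the
   entry. *)
rewrite -(enum_rankK_in iOm iOm) -(enum_rankK_in jOm jOm).
set k := enum_rank_in iOm i; set l := enum_rank_in jOm j.
have /matrixP /(_ k l) := cnM_principal A alpha Om; rewrite mxE => ->.
rewrite !row_colincl_in trmx_delta -rowE -colE ![in RHS]mxE enum_valP mul0rn.
by rewrite addr0.
Qed.

(** The diagonal of [cnZ] is 1 on [Om], so [gamma] disappears after restriction. *)
Lemma trmx_colincl_cnZ (R : realType) (n : nat) (gamma : R) (Om : {set 'I_n})
    (v : 'cV[R]_n) :
  (colincl R n Om)^T *m (cnZ gamma Om *m v) = (colincl R n Om)^T *m v.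
Proof.
apply/colP => k; rewrite !trmx_colincl_mulE.
by rewrite mul_diag_mx !mxE enum_valP mul1r.
Qed.

Lemma cnM_cnZ_quad (R : realType) (m n : nat) (A : 'M[R]_(m, n))
    (alpha gamma : R) (Om : {set 'I_n}) (v : 'cV[R]_n) :
  let u := (colincl R n Om)^T *m v in
  (v^T *m (cnM A alpha Om *m (cnZ gamma Om *m v))) 0 0 =
  (u^T *m (invmx (gram A Om) *m u)) 0 0 +
  alpha * gamma * \sum_(i | i \notin Om) v i 0 ^+ 2.
Proof.
move=> u; rewrite cnM_decomp mulmxDl mulmxDr mxE; congr (_ + _).
  by rewrite -!mulmxA trmx_colincl_cnZ -/u /u trmx_mul trmxK !mulmxA.
rewrite mulr_sumr [RHS]big_mkcond mxE; apply: eq_bigr => i _.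
rewrite mul_diag_mx mxE mul_diag_mx !mxE.
by case: (i \in Om) => /=; ring.
Qed.

(** Writing [B] for [colsubset A Om], [G = B^T B] and [u = G v], one gets [u^T v = v^T B^T B v], a
    squared norm. *)
Lemma gram_inv_quad (R : realType) (m n : nat) (A : 'M[R]_(m, n))
    (Om : {set 'I_n}) (u : 'cV[R]_#|Om|) :
  gram A Om \in unitmx ->
  let w := colsubset A Om *m (invmx (gram A Om) *m u) in
  (u^T *m (invmx (gram A Om) *m u)) 0 0 = (w^T *m w) 0 0.
Proof.
rewrite /= => Gu; rewrite -{1}[u](mulKVmx Gu).
set v := invmx _ *m u; clearbody v.
by rewrite {1}/gram !trmx_mul trmxK !mulmxA.
Qed.

Lemma gram_inv_quad_ge0 (R : realType) (m n : nat) (A : 'M[R]_(m, n))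
    (Om : {set 'I_n}) (u : 'cV[R]_#|Om|) :
  gram A Om \in unitmx -> 0 <= (u^T *m (invmx (gram A Om) *m u)) 0 0.
Proof. by move=> Gu; rewrite gram_inv_quad // trmx_mul_self_ge0. Qed.

Lemma gram_inv_quad_eq0 (R : realType) (m n : nat) (A : 'M[R]_(m, n))
    (Om : {set 'I_n}) (u : 'cV[R]_#|Om|) :
  gram A Om \in unitmx -> (u^T *m (invmx (gram A Om) *m u)) 0 0 = 0 -> u = 0.
Proof.
move=> Gu; rewrite gram_inv_quad // => /trmx_mul_self_eq0 w0.
(* From [w = B G^-1 u = 0] follows [u = G G^-1 u = B^T w = 0]. *)
by rewrite -[u](mulKVmx Gu) {1}/gram -mulmxA w0 mulmx0.
Qed.

Lemma cnM_cnZ_quad_gt0 (R : realType) (m n : nat) (A : 'M[R]_(m, n))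
    (alpha gamma : R) (Om : {set 'I_n}) (v : 'cV[R]_n) :
  0 < alpha -> 0 < gamma -> gram A Om \in unitmx -> v != 0 ->
  0 < (v^T *m (cnM A alpha Om *m (cnZ gamma Om *m v))) 0 0.
Proof.
move=> a0 c0 Gu v0; rewrite cnM_cnZ_quad.
have Q0 := gram_inv_quad_ge0 _ _ _ _ _ ((colincl R n Om)^T *m v) Gu.
have ac0 := mulr_gt0 a0 c0.
have S0 : 0 <= \sum_(i | i \notin Om) v i 0 ^+ 2.
  by apply: sumr_ge0 => i _; exact: sqr_ge0.
have T0 := mulr_ge0 (ltW ac0) S0.
rewrite lt_def (addr_ge0 Q0 T0) andbT.
(* If the sum is zero, both nonnegative terms are: the first kills the entries of [v] on [Om], the
   second those outside. *)
apply: contraNneq v0 => /eqP.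
rewrite (paddr_eq0 Q0 T0) mulf_eq0 (gt_eqF ac0) /=.
case/andP => /eqP /(gram_inv_quad_eq0 _ _ _ _ _ _ Gu) u0 /eqP.
move=> /psumr_eq0P sq0; apply/eqP/colP => i; rewrite [RHS]mxE.
have [iOm|iOm] := boolP (i \in Om).
  by rewrite -(enum_rankK_in iOm iOm) -trmx_colincl_mulE u0 mxE.
by apply/eqP; rewrite -sqrf_eq0 sq0 // => j _; exact: sqr_ge0.
Qed.

Theorem mainTheorem5 (R : realType) (m n q : nat) (A : 'M[R]_(m, n))
    (y : 'cV[R]_m) (alpha gamma : R) (x : 'cV[R]_n)
    (H : 'cV[R]_n -> 'cV[R]_n) (Om : {set 'I_n}) :
  (0 < q)%N -> 0 < alpha -> 0 < gamma ->
  hard_thresholding q H ->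
  Om = vsupport (H (A^T *m (y - A *m x))) ->
  gram A Om \in unitmx ->
  A^T *m (y - A *m x) != 0 ->
  descent_direction (least_squares A y) x
    (compressed_newton_direction A y alpha gamma Om x).
Proof.
move=> _ a0 c0 _ _ Gu g0.
rewrite /descent_direction gradient_least_squares /compressed_newton_direction.
(* The factor -2 of the gradient is extracted; being negative, it turns the goal into positivity of
   the quadratic form. *)
rewrite linearZ /= -scalemxAl mxE nmulr_rlt0 ?oppr_lt0 // -!mulmxA.
exact: cnM_cnZ_quad_gt0.
Qed.
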